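(* Let $s,t,v\ge0$ be integers. For all sufficiently large $n$ (depending on $s,t,v$) and every cache size $H\ge1$, any schedule, on the sequential machine with cache size $H$, of any execution DAG of the direct evaluation algorithm $\Psi^{(s,t,v)}$ for symmetric tensor contractions of dimension $n$ has vertical communication cost $$Q_\Psi(n,s,t,v,H)\ge\max\left[\frac{2\binom{n+s-1}{s}\binom{n+t-1}{t}\binom{n+v-1}{v}}{q\sqrt{H}},\ \binom{n+s+v-1}{s+v}+\binom{n+v+t-1}{v+t}+\binom{n+s+t-1}{s+t}\right],$$ where $q=\left[\binom{s+v}{s}\binom{v+t}{v}\binom{s+t}{s}\right]^{1/2}$.
   Context: Bilinear algorithm. A bilinear algorithm is a triple of real matrices $(F^{(A)},F^{(B)},F^{(C)})$ with the same number of columns. On input vectors $a,b$ it computes $c=F^{(C)}\big[((F^{(A)})^{\mathsf T}a)\odot((F^{(B)})^{\mathsf T}b)\big]$, $\odot$ being the entrywise product. Its rank is the number of columns. Tuples. Let $I_n^d=\{(i_1,\dots,i_d)\in\{1,\dots,n\}^d: i_1\le\dots\le i_d\}$, so $|I_n^d|=\binom{n+d-1}{d}$. For a tuple $k$ of length $q+r$, $\chi^q_r(k)$ is the collection of all pairs of tuples of lengths $q$ and $r$ obtained by choosing $q$ positions of $k$, listing the entries at these positions in order, and listing the remaining entries in order. For a tuple $k$ of length $v$, $\rho(k)=v!/\prod_i m_i!$ where $m_i$ are the multiplicities of the distinct values of $k$. Direct evaluation algorithm $\Psi^{(s,t,v)}$. It computes the symmetrized contraction over $v$ indices of a symmetric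 tensor $A$ of order $s+v$ with a symmetric tensor $B$ of order $v+t$ into a symmetric tensor $C$ of order $s+t$, all dimensions $n$, storing only entries with nondecreasing index tuples. As a bilinear algorithm: rows of $F^{(A)},F^{(B)},F^{(C)}$ are indexed by $I_n^{s+v},I_n^{v+t},I_n^{s+t}$ respectively (so $a,b,c$ are the unique entries of $A,B,C$), columns by triples $(j,l,k)\in I_n^s\times I_n^t\times I_n^v$. The only nonzeros are: $F^{(A)}_{g,(j,l,k)}=1$ if $(j,k)\in\chi^s_v(g)$; $F^{(B)}_{h,(j,l,k)}=1$ if $(k,l)\in\chi^v_t(h)$; $F^{(C)}_{i,(j,l,k)}=s!\,t!\,\rho(k)$ if $(j,l)\in\chi^s_t(i)$. Execution DAG. An execution DAG of a bilinear algorithm is a directed acyclic graph $G=(V,E)$ in which each vertex has in-degree $0$ (an input value, i.e. an entry of $a$ or $b$) or in-degree $2$ (the result of a weighted addition or of a multiplication of its two predecessors). $V$ is a disjoint union $V^{(A)}\cup V^{(B)}\cup V^{(C)}$: vertices of $V^{(A)}$ (resp. $V^{(B)}$) are linear combinations of entries of $a$ (resp. $b$), vertices of $V^{(C)}$ are the computed products and linear combinations of products; $V^{(M)}\subseteq V^{(C)}$ is the set of computed products, one for each column. The outputs (entries of $c$) are vertices of $V^{(C)}$. Edges go within $V^{(A)}$, within $V^{(B)}$ (these compute, by additions, the operands of the products), from $V^{(A)}$ to $V^{(M)}$ and from $V^{(B)}$ to $V^{(M)}$ (each product has exactly one operand from each), and from $V^{(C)}$ to $V^{(C)}\setminus V^{(M)}$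 (summations computing the outputs as prescribed by $F^{(C)}$). Sequential machine with cache size $H$. There is an unbounded main memory and a cache holding at most $H$ elements (one element per vertex value). A schedule is a total order of the operations of the execution DAG (compatible with the DAG), interleaved with reads (memory to cache), writes (cache to memory) and discards from cache; an operation requires its operands to be in cache and puts its result in cache. No element is computed more than once. Initially all inputs are in memory and none is in cache; at the end all outputs must have been written to memory. The vertical communication cost $Q$ is the total number of elements read plus the number written. *)

(* Defs.v *)
From HB Require Import structures.
From mathcomp Require Import all_boot all_order all_algebra.
From mathcomp Require Import reals.

Set Implicit Arguments.
Unset Strict Implicit.
Unset Printing Implicit Defensive.

Import Order.TTheory GRing.Theory Num.Theory.
Local Open Scope ring_scope.

(* On inputs a and b the algorithm computes FC *m ((FA^T *m a) .* (FB^T *m b)),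
   where .* is the entrywise product. *)
Record bilinear_algorithm (R : realType) := BilinearAlgorithm {
  nA : nat;
  nB : nat;
  nC : nat;
  brank : nat;
  FA : 'M[R]_(nA, brank);
  FB : 'M[R]_(nB, brank);
  FC : 'M[R]_(nC, brank) }.

Section Tuples.

(* I_n^d, with the index range {1, ..., n} shifted to {0, ..., n - 1}. *)
Definition sorted_tuple (n d : nat) :=
  {x : d.-tuple 'I_n | sorted leq [seq val i | i <- x]}.

(* A choice of q positions among the q + r positions of k is a boolean mask m;
   that m selects exactly q positions is forced by the size of p.1. *)
Definition chi (T : finType) (q r : nat) (k : (q + r).-tuple T) :
    {set q.-tuple T * r.-tuple T} :=
  [set p : q.-tuple T * r.-tuple T | [exists m : (q + r).-tuple bool,
     (mask m k == p.1 :> seq T) && (mask (map negb m) k == p.2 :> seq T)]].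

Definition rho (R : realType) (T : finType) (v : nat) (k : v.-tuple T) : R :=
  v`!%:R / (\prod_(x <- undup k) (count_mem x k)`!)%:R.

End Tuples.

Section DirectEvaluation.

Variables (R : realType) (n s t v : nat).

Let column := (sorted_tuple n s * sorted_tuple n t * sorted_tuple n v)%type.

Definition directA (g : sorted_tuple n (s + v)) (c : column) : R :=
  let: (j, l, k) := c in ((val j, val k) \in chi (val g))%:R.

Definition directB (h : sorted_tuple n (v + t)) (c : column) : R :=
  let: (j, l, k) := c in ((val k, val l) \in chi (val h))%:R.

Definition directC (i : sorted_tuple n (s + t)) (c : column) : R :=
  let: (j, l, k) := c in
  if (val j, val l) \in chi (val i) then s`!%:R * t`!%:R * rho R (val k) else 0.

Definition direct_evaluation : bilinear_algorithm R :=
  {| FA := \matrix_(g < #|{: sorted_tuple n (s + v)}|, c < #|{: column}|)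
             directA (enum_val g) (enum_val c);
     FB := \matrix_(h < #|{: sorted_tuple n (v + t)}|, c < #|{: column}|)
             directB (enum_val h) (enum_val c);
     FC := \matrix_(i < #|{: sorted_tuple n (s + t)}|, c < #|{: column}|)
             directC (enum_val i) (enum_val c) |}.

End DirectEvaluation.

Record digraph := Digraph { vertex :> finType; edge : rel vertex }.

Definition preds (G : digraph) (v : G) : {set G} := [set u | edge u v].

Definition acyclic (G : digraph) : Prop :=
  forall u v : G, edge u v -> ~~ connect (@edge G) v u.

Variant part := PartA | PartB | PartC.

(* Values are symbolic: a vertex of part A (resp. B) carries the vector of its
   coefficients on the entries of a (resp. b), and a vertex of part C the vector
   of its coefficients on the products, one for each column of the algorithm.

   Every edge carries a weight, and a vertex adds or multiplies its two weighted
   predecessors.  Weights are also allowed on the operands of a product, since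
   in-degree 1 is excluded and an entry of c may be a scalar multiple of a single
   product; an unscaled product is the case of two weights equal to 1. *)
Record execution_dag (R : realType) (alg : bilinear_algorithm R) :=
  ExecutionDag {
  graph :> digraph;
  dag_acyclic : acyclic graph;
  part_of : graph -> part;
  inA : 'I_(nA alg) -> graph;
  inB : 'I_(nB alg) -> graph;
  prodv : 'I_(brank alg) -> graph;
  outv : 'I_(nC alg) -> graph;
  weight : graph -> graph -> R;
  valA : graph -> 'cV[R]_(nA alg);
  valB : graph -> 'cV[R]_(nB alg);
  valC : graph -> 'rV[R]_(brank alg);
  dag_indegree : forall x : graph, #|preds x| = 0%N \/ #|preds x| = 2%N;
  dag_inputs : forall x : graph,
    preds x = set0 <-> (exists i, x = inA i) \/ (exists i, x = inB i);
  dag_inA : forall i, part_of (inA i) = PartA /\ valA (inA i) = delta_mx i 0;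
  dag_inB : forall i, part_of (inB i) = PartB /\ valB (inB i) = delta_mx i 0;
  dag_sumA : forall x : graph, part_of x = PartA -> preds x <> set0 ->
    (forall u, edge u x -> part_of u = PartA) /\
    valA x = \sum_(u in preds x) weight u x *: valA u;
  dag_sumB : forall x : graph, part_of x = PartB -> preds x <> set0 ->
    (forall u, edge u x -> part_of u = PartB) /\
    valB x = \sum_(u in preds x) weight u x *: valB u;
  dag_prod_inj : injective prodv;
  dag_prod : forall r, part_of (prodv r) = PartC /\
    exists y z : graph,
      [/\ preds (prodv r) = [set y; z],
          part_of y = PartA /\ valA y = col r (FA alg),
          part_of z = PartB /\ valB z = col r (FB alg)
        & valC (prodv r) =
            (weight y (prodv r) * weight z (prodv r)) *: delta_mx 0 r];
  dag_sumC : forall x : graph, part_of x = PartC -> (forall r, x <> prodv r) ->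
    (forall u, edge u x -> part_of u = PartC) /\
    valC x = \sum_(u in preds x) weight u x *: valC u;
  dag_out : forall i, part_of (outv i) = PartC /\ valC (outv i) = row i (FC alg)
}.

Variant instr (V : Type) :=
  | Compute of V
  | Read of V
  | Write of V
  | Discard of V.

Record machine_state (V : finType) :=
  MachineState { cache : {set V}; memory : {set V} }.

Section Machine.

Variables (R : realType) (alg : bilinear_algorithm R) (G : execution_dag alg).
Variable H : nat.

Definition input_vertices : {set G} := [set x : G | preds x == set0].

(* The result of an operation occupies a cache slot in addition to those of its
   operands, which stay in cache until they are discarded. *)
Definition step (st : machine_state G) (i : instr G) :
    option (machine_state G) :=
  match i with
  | Compute x =>
      if (preds x \subset cache st) && (#|x |: cache st| <= H)%N
      then Some (MachineState (x |: cache st) (memory st)) else None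
  | Read x =>
      if (x \in memory st) && (#|x |: cache st| <= H)%N
      then Some (MachineState (x |: cache st) (memory st)) else None
  | Write x =>
      if x \in cache st
      then Some (MachineState (cache st) (x |: memory st)) else None
  | Discard x => Some (MachineState (cache st :\ x) (memory st))
  end.

Fixpoint run (st : machine_state G) (w : seq (instr G)) :
    option (machine_state G) :=
  if w is i :: w' then obind (run^~ w') (step st i) else Some st.

Definition computed (w : seq (instr G)) : seq G :=
  pmap (fun i => if i is Compute x then Some x else None) w.

(* The first condition says that the Compute instructions form a total order of
   the operations of the DAG, so that each of them is performed exactly once. *)
Definition is_schedule (w : seq (instr G)) : Prop :=
  perm_eq (computed w) (enum (~: input_vertices)) /\
  exists2 st, run (MachineState set0 input_vertices) w = Some st
            & forall i, outv G i \in memory st.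

Definition is_transfer (i : instr G) : bool :=
  match i with Read _ | Write _ => true | _ => false end.

Definition vertical_cost (w : seq (instr G)) : nat := count is_transfer w.

End Machine.

(* Main.v *)
(* Cut the schedule into segments computing m products each.  If the products of
   a segment involve x entries of A, y of B and z of C, then Loomis-Whitney and
   the bound C(q + r, q) on #|chi g| give m^2 <= q^2 x y z.  The entries of A and
   B are spanned by what is in cache at the start of the segment or read during
   it, those of C by what is in cache at its end or written during it.  Hence the
   costs of the segments add up to at least the sum of the x + y + z minus H for
   each interior boundary, and m ~ q H^(3/2) makes x + y + z at least 3 H, which
   leaves 2 H per segment. *)

Require Import Defs.
From mathcomp Require Import all_boot all_order all_algebra.
From mathcomp Require Import reals.
From mathcomp Require Import zify.

Set Implicit Arguments.
Unset Strict Implicit.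
Unset Printing Implicit Defensive.

Import Order.TTheory GRing.Theory Num.Theory.
Local Open Scope ring_scope.

(** * Counting inequalities and a rank argument *)

Lemma leq_sqr_sum (I : finType) (A : {set I}) (f : I -> nat) :
  ((\sum_(i in A) f i) ^ 2 <= #|A| * \sum_(i in A) f i ^ 2)%N.
Proof.
rewrite -(@leq_pmul2l 2) // -mulnn big_distrlr /= mulnA.
(* Sum [2 * f i * f j <= f i ^ 2 + f j ^ 2] over all pairs in [A]. *)
have -> : (2 * #|A| * \sum_(i in A) f i ^ 2 =
    \sum_(i in A) \sum_(j in A) (f i ^ 2 + f j ^ 2))%N.
  under [RHS]eq_bigr => i _ do rewrite big_split sum_nat_const /=.
  by rewrite big_split /= -big_distrr sum_nat_const /=; lia.
rewrite big_distrr /=; apply: leq_sum => i _.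
by rewrite big_distrr /=; apply: leq_sum => j _; exact: nat_Cauchy.
Qed.

Lemma leq_card_fibres (I J : finType) (f : I -> J) (A : {set I}) (k : nat) :
  (forall j, #|[set i in A | f i == j]| <= k)%N -> (#|A| <= k * #|f @: A|)%N.
Proof.
move=> fk; rewrite -sum1_card (partition_big_imset f) /= mulnC -sum_nat_const.
apply: leq_sum => j _; apply: leq_trans (fk j); rewrite sum1_card.
by apply/eq_leq/eq_card => i; rewrite inE.
Qed.

(* Cauchy-Schwarz over the pairs (x, y), then the injection
   (x, y, z, z') |-> ((x, z), (z', y)). *)
Lemma loomis_whitney (X Y Z : finType) (S : {set X * Y * Z}) :
  (#|S| ^ 2 <= #|[set (c.1.1, c.2) | c in S]| * #|[set (c.2, c.1.2) | c in S]|
               * #|[set c.1 | c in S]|)%N.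
Proof.
have -> : #|S| = (\sum_(p in [set c.1 | c in S]) #|[set c in S | c.1 == p]|)%N.
  rewrite -sum1_card (partition_big_imset fst) /=; apply: eq_bigr => p _.
  by rewrite -sum1_card; apply: eq_bigl => c; rewrite inE.
apply: leq_trans (leq_sqr_sum _ _) _; rewrite mulnC leq_mul2r; apply/orP; right.
(* The squared fibre sizes count the pairs of points of [S] that agree in their first two
   coordinates. *)
set D := [set d : (X * Y * Z) * (X * Y * Z) |
           [&& d.1 \in S, d.2 \in S & d.1.1 == d.2.1]].
have -> : (\sum_(p in [set c.1 | c in S]) #|[set c in S | c.1 == p]| ^ 2 = #|D|)%N.
  rewrite -sum1_card (partition_big (fun d => d.1.1) (mem [set c.1 | c in S])) /=.
    apply: eq_bigr => p _; rewrite -mulnn -cardsX -sum1_card.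
    apply: eq_bigl => -[d e]; rewrite !inE /=.
    case: (d \in S) => //=; case: (e \in S) => /=; last by rewrite andbF.
    by rewrite [in RHS]andbC; case: eqP => //= ->; rewrite eq_sym.
  by move=> [d e]; rewrite inE => /and3P[dS _ _]; apply: imset_f.
rewrite -cardsX.
have finj : {in D &, injective
    (fun d : (X * Y * Z) * (X * Y * Z) => ((d.1.1.1, d.1.2), (d.2.2, d.2.1.2)))}.
  move=> [[[a b] c] [[a' b'] c']] [[[x y] z] [[x' y'] z']].
  rewrite !inE /= => /and3P[_ _ /eqP[<- <-]] /and3P[_ _ /eqP[<- <-]].
  by move=> [-> -> -> ->].
rewrite -(card_in_imset finj); apply: subset_leq_card; apply/subsetP => p.
case/imsetP => -[d e]; rewrite inE /= => /and3P[dS eS _] ->.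
by rewrite inE /=; apply/andP; split; [apply/imsetP; exists d | apply/imsetP; exists e].
Qed.

(** The identity matrix of size [p] factors through [size X] dimensions: coordinates of the [e i] in
    [X], times the entries of [X] in the columns [c j]. *)
Lemma leq_dual_family (R : fieldType) (N p : nat) (X : seq 'rV[R]_N)
    (e : 'I_p -> 'rV[R]_N) (c : 'I_p -> 'I_N) :
  (forall i, e i \in <<X>>%VS) -> (forall i j, e i 0 (c j) = (i == j)%:R) ->
  (p <= size X)%N.
Proof.
move=> eX ec.
pose L := \matrix_(i < p, k < size X) coord (in_tuple X) k (e i).
pose V := \matrix_(k < size X, j < p) X`_k 0 (c j).
apply: (@mulmx1_min _ _ _ L V); apply/matrixP => i j.
rewrite !mxE -ec (@coord_span _ _ _ (in_tuple X) (e i)) // summxE.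
by apply: eq_bigr => k _; rewrite !mxE.
Qed.

(** * Runs of the machine and the values that pass through its cache *)

Section Schedule.

Variables (R : realType) (alg : bilinear_algorithm R) (G : execution_dag alg).
Variable H : nat.
Implicit Types (w : seq (instr G)) (st : machine_state G).

Definition reads w : seq G := pmap (fun i => if i is Read x then Some x else None) w.
Definition writes w : seq G := pmap (fun i => if i is Write x then Some x else None) w.

Lemma cost_reads_writes w : vertical_cost w = (size (reads w) + size (writes w))%N.
Proof. by elim: w => //= -[] x w /= ->; rewrite ?add0n ?add1n ?addSn ?addnS. Qed.

Lemma computed_cat w1 w2 : computed (w1 ++ w2) = computed w1 ++ computed w2.
Proof. exact: pmap_cat. Qed.

Lemma run_cat st w1 w2 :
  run H st (w1 ++ w2) = obind (fun st1 => run H st1 w2) (run H st w1).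
Proof. by elim: w1 st => //= i w IH st; case: (step H st i). Qed.

(** [P] is carried along the flow of data: a vertex enters the cache by being read or by being
    computed from cached operands, and only cached vertices are written. *)
Lemma run_invariant (P : G -> Prop) w st st' :
    run H st w = Some st' -> (forall x, x \in cache st -> P x) ->
    (forall x, x \in memory st -> x \in reads w -> P x) ->
    (forall x, x \in computed w -> (forall u, u \in preds x -> P u) -> P x) ->
  [/\ forall x, x \in cache st' -> P x,
      forall x, x \in computed w -> forall u, u \in preds x -> P u
    & forall x, x \in memory st' -> x \in memory st \/ x \in writes w /\ P x].
Proof.
elim: w st => [|i w IH] st /=.
  by move=> [<-] Pc _ _; split=> // x; left.
case: i => x /=.
- case: ifP => // /andP[sub _] rw Pc Pm Pcl.
  have Ppx u : u \in preds x -> P u by move/(subsetP sub)/Pc.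
  have Px : P x by apply: Pcl; rewrite ?inE ?eqxx.
  have [|||Pc' Pp' Pm'] := IH _ rw => //.
  + by move=> y /setU1P[->|/Pc].
  + by move=> y yw; apply: Pcl; rewrite inE yw orbT.
  + by split=> // y; rewrite inE => /predU1P[->|/Pp'].
- case: ifP => // /andP[xm _] rw Pc Pm Pcl.
  have Px : P x by apply: Pm; rewrite ?inE ?eqxx.
  have [|||Pc' Pp' Pm'] := IH _ rw => //.
  + by move=> y /setU1P[->|/Pc].
  + by move=> y ym yw; apply: Pm; rewrite // inE yw orbT.
- case: ifP => // xc rw Pc Pm Pcl.
  have [|||Pc' Pp' Pm'] := IH _ rw => //.
  + by move=> y /setU1P[-> _|/Pm]; [apply: Pc|].
  split=> // y /Pm'[/setU1P[->|]|[yw Py]]; last by right; rewrite inE yw orbT.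
  + by right; rewrite inE eqxx; split=> //; apply: Pc.
  + by left.
- move=> rw Pc Pm Pcl.
  have [|||Pc' Pp' Pm'] := IH _ rw => //.
  by move=> y /setD1P[_ /Pc].
Qed.

Lemma run_cache_bound w st st' :
  run H st w = Some st' -> (#|cache st| <= H)%N -> (#|cache st'| <= H)%N.
Proof.
elim: w st => [|i w IH] st /=; first by move=> [<-].
case: i => x /= rw le; move: rw.
- by case: ifP => // /andP[_ xle] rw; apply: IH rw _.
- by case: ifP => // /andP[_ xle] rw; apply: IH rw _.
- by case: ifP => // _ rw; apply: IH rw _.
- move=> rw; apply: IH rw _; apply: leq_trans le.
  by rewrite subset_leq_card // subD1set.
Qed.

Lemma run_compute_bound w st st' x :
  run H st w = Some st' -> x \in computed w -> (#|x |: preds x| <= H)%N.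
Proof.
elim: w st => [|i w IH] st //=.
case: i => y /=; try by case: ifP => // _ /IH.
  case: ifP => // /andP[sub le] rw; rewrite inE => /predU1P[->|]; last exact: IH rw.
  by apply: leq_trans le; rewrite subset_leq_card // setUS.
exact: IH.
Qed.

Lemma run_discard st (xs : seq G) :
  run H st [seq Discard x | x <- xs]
  = Some (MachineState (cache st :\: [set x in xs]) (memory st)).
Proof.
elim: xs st => [|x xs IH] [c m] /=.
  by congr (Some (MachineState _ _)); apply/setP => y; rewrite !inE.
rewrite IH /=; congr (Some (MachineState _ _)); apply/setP => y.
by rewrite !inE negb_or; case: (y == x); rewrite /= ?andbF.
Qed.

Definition isA (x : G) := if part_of x is PartA then true else false.
Definition isB (x : G) := if part_of x is PartB then true else false.
Definition isC (x : G) := if part_of x is PartC then true else false.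

Lemma isAP x : reflect (part_of x = PartA) (isA x).
Proof. by rewrite /isA; case E: (part_of x); constructor. Qed.
Lemma isBP x : reflect (part_of x = PartB) (isB x).
Proof. by rewrite /isB; case E: (part_of x); constructor. Qed.
Lemma isCP x : reflect (part_of x = PartC) (isC x).
Proof. by rewrite /isC; case E: (part_of x); constructor. Qed.

Definition products w : {set 'I_(brank alg)} := [set r | prodv G r \in computed w].

(** Counted along the list of operations, hence additive over consecutive segments. *)
Definition product_count w := count (mem (codom (prodv G))) (computed w).

Lemma card_products w : uniq (computed w) -> #|products w| = product_count w.
Proof.
move=> uw; rewrite -(card_imset _ (@dag_prod_inj _ _ G)) /product_count -size_filter.
rewrite -(card_uniqP (filter_uniq _ uw)); apply: eq_card => x.
rewrite mem_filter; apply/imsetP/andP => [[r]|[/codomP[r ->] rw]].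
  by rewrite inE => rw ->; split=> //; apply: codom_f.
by exists r; rewrite ?inE.
Qed.

(* Of each product, the segment has one operand of the given part in cache, and
   it lies in the span of the operands that were in cache or have been read. *)
Lemma card_operands (N : nat) (g : 'I_(brank alg) -> 'I_N) (isX : pred G)
    (val : G -> 'rV[R]_N) w st st' :
    (forall x, x \notin input_vertices G -> isX x ->
       (forall u, u \in preds x -> isX u) /\
       val x = \sum_(u in preds x) weight u x *: val u) ->
    (forall r, exists y, [/\ y \in preds (prodv G r), isX y
                           & val y = delta_mx 0 (g r)]) ->
    (forall x, x \in computed w -> x \notin input_vertices G) ->
    run H st w = Some st' ->
  (#|g @: products w| <= #|[set x in cache st | isX x]| + count isX (reads w))%N.
Proof.
move=> sumX prodX compw rw.
pose Y := [seq val x | x <- enum [set x in cache st | isX x] ++ filter isX (reads w)].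
have -> : (#|[set x in cache st | isX x]| + count isX (reads w) = size Y)%N.
  by rewrite size_map size_cat size_filter cardE.
pose P x := isX x -> val x \in <<Y>>%VS.
have [|||_ Pw _] := @run_invariant P w st st' rw.
- move=> x xc Xx; apply/memv_span/map_f.
  by rewrite mem_cat mem_enum in_set xc Xx.
- move=> x _ xw Xx; apply/memv_span/map_f.
  by rewrite mem_cat (mem_filter isX) Xx xw orbT.
- move=> x /compw xI Pp Xx; have [Xp ->] := sumX x xI Xx.
  by apply: memv_suml => u up; apply/memvZ/Pp/Xp.
pose e (i : 'I_#|g @: products w|) : 'rV[R]_N := delta_mx 0 (enum_val i).
apply: (@leq_dual_family _ _ _ _ e enum_val) => [i|i j]; last first.
  by rewrite mxE eqxx (inj_eq enum_val_inj) eq_sym.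
have /imsetP[r] := enum_valP i; rewrite inE => rw' eir.
have [y [yp Xy vy]] := prodX r.
by rewrite /e eir -vy; apply: Pw rw' _ yp Xy.
Qed.


Lemma input_notC x : x \in input_vertices G -> ~~ isC x.
Proof.
rewrite inE => /eqP/dag_inputs[] [i ->]; rewrite /isC.
  by have [-> _] := dag_inA G i.
by have [-> _] := dag_inB G i.
Qed.

Lemma sum_partA x : x \notin input_vertices G -> isA x ->
  (forall u, u \in preds x -> isA u) /\
  (valA x)^T = \sum_(u in preds x) weight u x *: (valA u)^T.
Proof.
rewrite inE => /eqP xI /isAP xA; have [pA ->] := dag_sumA xA xI.
split=> [u|]; first by rewrite inE => /pA/isAP.
by rewrite linear_sum; apply: eq_bigr => u _; rewrite linearZ.
Qed.

Lemma sum_partB x : x \notin input_vertices G -> isB x ->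
  (forall u, u \in preds x -> isB u) /\
  (valB x)^T = \sum_(u in preds x) weight u x *: (valB u)^T.
Proof.
rewrite inE => /eqP xI /isBP xB; have [pB ->] := dag_sumB xB xI.
split=> [u|]; first by rewrite inE => /pB/isBP.
by rewrite linear_sum; apply: eq_bigr => u _; rewrite linearZ.
Qed.

Definition initial_state : machine_state G :=
  MachineState set0 (input_vertices G).

(* Restricted to the columns computed in the segment [w2], the outputs span
   [#|g @: products w2|] dimensions; everything computed before [w2] vanishes
   there, so this much has to pass through cache or memory at its end. *)
Lemma card_outputs (g : 'I_(brank alg) -> 'I_(nC alg)) (a : 'I_(brank alg) -> R)
    w1 w2 w3 st1 st2 st3 :
    (forall r, a r != 0) ->
    (forall i r, FC alg i r = if i == g r then a r else 0) ->
    uniq (computed (w1 ++ w2 ++ w3)) ->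
    (forall x, x \in computed (w1 ++ w2 ++ w3) -> x \notin input_vertices G) ->
    run H initial_state w1 = Some st1 -> run H st1 w2 = Some st2 ->
    run H st2 w3 = Some st3 -> (forall i, outv G i \in memory st3) ->
  (#|g @: products w2| <= #|[set x in cache st2 | isC x]| + count isC (writes w2))%N.
Proof.
move=> a0 FCE uw nin rw1 rw2 rw3 outm.
set S := products w2.
(* Projection onto the columns whose products are computed in [w2]. *)
pose D : 'M[R]_(brank alg) := diag_mx (\row_r (r \in S)%:R).
pose Y := [seq valC x *m D |
  x <- enum [set x in cache st2 | isC x] ++ filter isC (writes w2)].
have -> : (#|[set x in cache st2 | isC x]| + count isC (writes w2) = size Y)%N.
  by rewrite size_map size_cat size_filter cardE.
pose P (U : {vspace 'rV[R]_(brank alg)}) x := isC x -> valC x *m D \in U.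
(* Outside [w2] no new dimension arises: [D] kills a product not computed in [w2], and a sum stays
   in any subspace containing its summands. *)
have closed U x : x \notin computed w2 -> (forall u, u \in preds x -> P U u) -> P U x.
  move=> xw2 Pp Cx; case: (boolP (x \in codom (prodv G))) => [/codomP[r xr]|xp].
    have [_ [y [z [_ _ _ +]]]] := dag_prod G r; rewrite -xr => ->.
    have -> : (weight y x * weight z x) *: delta_mx 0 r *m D = 0
      :> 'rV_(brank alg); last exact: mem0v.
    apply/rowP => k; rewrite mul_mx_diag !mxE eqxx /=.
    case: eqVneq => [->|]; rewrite ?mulr0 ?mul0r //.
    by rewrite inE -xr (negbTE xw2) mulr0.
  have xp' r : x <> prodv G r by move=> xr; rewrite xr codom_f in xp.
  have [Cp ->] := dag_sumC (elimT (isCP x) Cx) xp'.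
  rewrite mulmx_suml; apply: memv_suml => u up.
  rewrite -scalemxAl; apply/memvZ/Pp => //.
  by apply/isCP/Cp; rewrite inE in up.
move: (uw); rewrite !computed_cat cat_uniq has_cat negb_or.
case/and3P=> _ /andP[d12 _]; rewrite cat_uniq => /and3P[_ d23 _].
have d12' x : x \in computed w1 -> x \notin computed w2.
  by move=> x1; apply/negP => x2; case/negP: d12; apply/hasP; exists x.
have d23' x : x \in computed w3 -> x \notin computed w2.
  by move=> x3; apply/negP => x2; case/negP: d23; apply/hasP; exists x.
(* Three passes: before [w2] all values of part C vanish under [D]; during [w2] only the origin of
   the memory contents is tracked; after it all values lie in the span of [Y]. *)
have [|||_ _ m1] := @run_invariant (P 0%VS) w1 _ _ rw1.
- by move=> x; rewrite inE.
- by move=> x xI _ Cx; have := input_notC xI; rewrite Cx.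
- by move=> x /d12'; apply: closed.
have [//|//|//|_ _ m2] := @run_invariant (fun _ => True) w2 _ _ rw2.
have [|||_ _ m3] := @run_invariant (P <<Y>>%VS) w3 _ _ rw3.
- move=> x xc Cx; apply/memv_span/map_f.
  by rewrite mem_cat mem_enum in_set xc Cx.
- move=> x xm _ Cx; have [/m1[xI|[_ Px]]|[xw _]] := m2 _ xm.
  + by have := input_notC xI; rewrite Cx.
  + by move: (Px Cx); rewrite memv0 => /eqP ->; apply: mem0v.
  + by apply/memv_span/map_f; rewrite mem_cat (mem_filter isC) Cx xw orbT.
- by move=> x /d23'; apply: closed.
have outY i : row i (FC alg) *m D \in <<Y>>%VS.
  have [/isCP Ci <-] := dag_out G i.
  have [om|[_ Po]] := m3 _ (outm i); last exact: Po.
  have [/m1[xI|[_ Px]]|[xw _]] := m2 _ om.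
  - by have := input_notC xI; rewrite Ci.
  - by move: (Px Ci); rewrite memv0 => /eqP ->; apply: mem0v.
  - by apply/memv_span/map_f; rewrite mem_cat (mem_filter isC) Ci xw orbT.
have /fin_all_exists[c cP] : forall i : 'I_#|g @: S|,
    exists r, r \in S /\ g r = enum_val i.
  by move=> i; have /imsetP[r rS gr] := enum_valP i; exists r.
(* In column [c j] the [i]-th of these rows has entry [a (c i)] if [i = j] and 0 otherwise, whence
   the scaling to a dual family. *)
pose e i := (a (c i))^-1 *: (row (enum_val i) (FC alg) *m D).
apply: (@leq_dual_family _ _ _ _ e c) => [i|i j]; first by apply/memvZ/outY.
have [cjS gcj] := cP j; have [ciS gci] := cP i.
rewrite /e mul_mx_diag !mxE cjS mulr1 FCE gcj (inj_eq enum_val_inj).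
by case: eqP => [->|_]; rewrite ?mulVf ?mulr0.
Qed.

(** Were entry [i] never read, coordinate [i] would vanish in every cached value of that part, while
    some product has the [i]-th unit vector as an operand. *)
Lemma inputs_read (N : nat) (g : 'I_(brank alg) -> 'I_N) (isX : pred G)
    (val : G -> 'rV[R]_N) (inX : 'I_N -> G) w st :
    (forall x, x \notin input_vertices G -> isX x ->
       (forall u, u \in preds x -> isX u) /\
       val x = \sum_(u in preds x) weight u x *: val u) ->
    (forall r, exists y, [/\ y \in preds (prodv G r), isX y
                           & val y = delta_mx 0 (g r)]) ->
    (forall x, x \in input_vertices G -> isX x -> exists i, x = inX i) ->
    (forall i, val (inX i) = delta_mx 0 i) ->
    (forall i, exists r, g r = i) ->
    run H initial_state w = Some st ->
    (forall x, x \in computed w -> x \notin input_vertices G) ->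
    (forall r, prodv G r \in computed w) ->
  forall i, inX i \in reads w.
Proof.
move=> sumX prodX inP valin gsurj rw nin prw i; apply/negPn/negP => iw.
pose P x := isX x -> val x 0 i = 0.
have [|||_ Pw _] := @run_invariant P w _ _ rw.
- by move=> x; rewrite inE.
- move=> x xI xr Xx; have [j xj] := inP x xI Xx.
  rewrite xj valin mxE eqxx /=; case: eqP => // ij.
  by rewrite ij -xj xr in iw.
- move=> x /nin xI Pp Xx; have [Xp ->] := sumX x xI Xx.
  rewrite summxE big1 // => u up; rewrite mxE Pp ?mulr0 //.
  exact: Xp.
have [r gr] := gsurj i; have [y [yp Xy vy]] := prodX r.
have := Pw _ (prw r) _ yp Xy; rewrite vy gr mxE !eqxx.
by move/eqP; rewrite oner_eq0.
Qed.


Lemma cost_cat w1 w2 :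
  vertical_cost (w1 ++ w2) = (vertical_cost w1 + vertical_cost w2)%N.
Proof. exact: count_cat. Qed.

Lemma card_sep (A : {set G}) (p : pred G) :
  #|[set x in A | p x]| = count p (enum A).
Proof.
rewrite -size_filter -(card_uniqP (filter_uniq p (enum_uniq (mem A)))).
by apply: eq_card => x; rewrite inE mem_filter mem_enum andbC.
Qed.

Lemma count_operands (xs : seq G) :
  (count isA xs + count isB xs <= count (predC isC) xs)%N.
Proof.
elim: xs => //= x xs IH; rewrite addnACA leq_add //.
by rewrite /isA /isB /isC; case: (part_of x).
Qed.

(** One instruction computes at most one product, so the count along prefixes takes every
    intermediate value. *)
Lemma split_product_count m w : (m <= product_count w)%N ->
  exists w1 w2, w = w1 ++ w2 /\ product_count w1 = m.
Proof.
elim: w m => [|i w IH] m; first by rewrite leqn0 => /eqP ->; exists [::], [::].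
case: m => [|m]; first by exists [::], (i :: w).
rewrite /product_count -cat1s computed_cat count_cat -!/(product_count _).
have : (product_count [:: i] <= 1)%N.
  by case: i => x; rewrite /product_count //= addn0 leq_b1.
case ci: (product_count [:: i]) => [|[]] // _.
- rewrite add0n => /IH[w1 [w2 [-> cw1]]]; exists (i :: w1), w2.
  rewrite -[i :: w1]cat1s /product_count computed_cat count_cat.
  by rewrite -!/(product_count _) ci cw1.
- rewrite add1n ltnS => /IH[w1 [w2 [-> cw1]]]; exists (i :: w1), w2.
  rewrite -[i :: w1]cat1s /product_count computed_cat count_cat.
  by rewrite -!/(product_count _) ci cw1.
Qed.

(** A product and its two operands sit in cache together. This supplies the size condition of
    [exists_block_size]. *)
Lemma cache_size_gt2 w st st' r : run H st w = Some st' ->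
  prodv G r \in computed w -> (3 <= H)%N.
Proof.
move=> rw rc; apply: leq_trans (run_compute_bound rw rc).
have pr : prodv G r \notin preds (prodv G r).
  by rewrite inE; apply/negP => /dag_acyclic; rewrite connect0.
rewrite cardsU1 pr; have [p0|->] // := dag_indegree (prodv G r).
have [_ [y [z [pyz _ _ _]]]] := dag_prod G r.
by move/eqP: p0; rewrite cards_eq0 pyz => /eqP/setP/(_ y); rewrite !inE eqxx.
Qed.

End Schedule.

(** * Arithmetic behind the segment length *)

Lemma leq_amgm3 a b c : (27 * (a * b * c) <= (a + b + c) ^ 3)%N.
Proof.
wlog ab : a b c / (a <= b)%N.
  move=> W; case: (leqP a b) => [|/ltnW] /W; first exact.
  by move/(_ c); rewrite (mulnC b) (addnC b).
wlog ac : a b c ab / (a <= c)%N.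
  move=> W; case: (leqP a c) => [ac|ca]; first exact: W.
  have := W c a b (ltnW ca) (leq_trans (ltnW ca) ab); lia.
have [x bx] : exists x, b = (a + x)%N by exists (b - a)%N; rewrite subnKC.
have [y cy] : exists y, c = (a + y)%N by exists (c - a)%N; rewrite subnKC.
(* With [a] smallest, the two sides differ by [9 a (x^2 - x y + y^2) + (x + y)^3]. *)
subst b c; have := (nat_Cauchy x y).1; nia.
Qed.

Lemma leq_mul3_lt_sum a b c h : (a + b + c < 3 * h)%N ->
  (a * b * c <= h ^ 2 * h.-1)%N.
Proof.
wlog ab : a b c / (a <= b)%N.
  move=> W; case: (leqP a b) => [|/ltnW] /W; first exact.
  by move/(_ c); rewrite (mulnC b) (addnC b).
wlog ac : a b c ab / (a <= c)%N.
  move=> W; case: (leqP a c) => [ac|ca]; first exact: W.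
  have := W c a b (ltnW ca) (leq_trans (ltnW ca) ab); lia.
move=> abc; have [x hx] : exists x, h = (a + x).+1.
  by exists (h - a.+1)%N; lia.
(* [b + c <= 2 h + x], since the three numbers sum to at most [3 h - 1] and [a = h - 1 - x]. *)
have bc : (4 * (b * c) <= (2 * h + x) ^ 2)%N.
  apply: leq_trans (nat_AGM2 b c).1 _; rewrite leq_sqr; lia.
have abc4 : (4 * (a * b * c) <= a * (2 * h + x) ^ 2)%N.
  by rewrite -mulnA mulnCA leq_mul2l bc orbT.
suff : (a * (2 * h + x) ^ 2 <= 4 * (h ^ 2 * h.-1))%N by lia.
by rewrite hx /=; nia.
Qed.

(* h^2 (h - 1) is the maximum of x y z under x + y + z < 3 h. *)
Lemma exists_block_size K h : (0 < K)%N -> (2 < h)%N ->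
  exists m, (K * (h ^ 2 * h.-1) < m ^ 2 <= K * h ^ 3)%N.
Proof.
move=> K0 h2; set X := (K * (h ^ 2 * h.-1))%N.
have exm : exists m, (X < m ^ 2)%N by exists X.+1; nia.
(* The least [m] with [X < m ^ 2] works, provided that the step from [k ^ 2] to [(k + 1) ^ 2] fits
   into the gap [K * h ^ 2]. *)
case: (ex_minnP exm) => m Xm mmin; exists m; rewrite Xm /=.
case: m Xm mmin => [|k] // Xk kmin.
have kX : (k ^ 2 <= X)%N.
  by rewrite leqNgt; apply/negP => /kmin; rewrite ltnn.
have -> : (K * h ^ 3 = X + K * h ^ 2)%N.
  by rewrite /X; clear -h2; case: h h2 => //= h _; nia.
suff : (2 * k + 1 <= K * h ^ 2)%N by nia.
(* Otherwise [K h^2 <= 2 k]; squaring gives [K h^2 <= 4 (h - 1)], impossible since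
   [(h - 2)^2 > 0]. *)
rewrite leqNgt; apply/negP => kh.
have : ((K * h ^ 2) ^ 2 <= 4 * X)%N.
  apply: (@leq_trans ((2 * k) ^ 2)); last by nia.
  by rewrite leq_sqr; lia.
have -> : ((K * h ^ 2) ^ 2 = K * h ^ 2 * (K * h ^ 2))%N by rewrite mulnn.
have -> : (4 * X = K * h ^ 2 * (4 * h.-1))%N by rewrite /X; lia.
rewrite leq_pmul2l; last by rewrite muln_gt0 K0 expn_gt0; lia.
by clear -h2 K0; case: h h2 => //= h; nia.
Qed.

(** A Loomis-Whitney inequality up to the factor [K], which will be [q ^ 2]. The maps will give the
    row of the only nonzero entry of a column in each matrix. *)
Definition expansion (r nA nB nC K : nat) (gA : 'I_r -> 'I_nA)
    (gB : 'I_r -> 'I_nB) (gC : 'I_r -> 'I_nC) : Prop :=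
  forall S : {set 'I_r},
    (#|S| ^ 2 <= K * (#|gA @: S| * #|gB @: S| * #|gC @: S|))%N.

(** * Lower bounds for algorithms whose matrices have one nonzero entry per column *)

Section LowerBound.

Variables (R : realType) (alg : bilinear_algorithm R).
Variables (gA : 'I_(brank alg) -> 'I_(nA alg)) (gB : 'I_(brank alg) -> 'I_(nB alg)).
Variables (gC : 'I_(brank alg) -> 'I_(nC alg)) (a : 'I_(brank alg) -> R) (K : nat).
Hypothesis FAE : forall i r, FA alg i r = (i == gA r)%:R.
Hypothesis FBE : forall i r, FB alg i r = (i == gB r)%:R.
Hypothesis a_neq0 : forall r, a r != 0.
Hypothesis FCE : forall i r, FC alg i r = if i == gC r then a r else 0.
Variables (G : execution_dag alg) (H : nat).
Implicit Types (w : seq (instr G)) (st : machine_state G).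

Lemma prod_operandA r : exists y : G,
  [/\ y \in preds (prodv G r), isA y & (valA y)^T = delta_mx 0 (gA r)].
Proof.
have [_ [y [z [pyz [/isAP Ay vy] _ _]]]] := dag_prod G r.
exists y; rewrite pyz !inE eqxx; split=> //.
by apply/rowP => i; rewrite vy !mxE eqxx FAE.
Qed.

Lemma prod_operandB r : exists y : G,
  [/\ y \in preds (prodv G r), isB y & (valB y)^T = delta_mx 0 (gB r)].
Proof.
have [_ [y [z [pyz _ [/isBP Bz vz] _]]]] := dag_prod G r.
exists z; rewrite pyz !inE eqxx orbT; split=> //.
by apply/rowP => i; rewrite vz !mxE eqxx FBE.
Qed.

Lemma schedule_not_input w : is_schedule H w ->
  forall x, x \in computed w -> x \notin input_vertices G.
Proof. by case=> pw _ x; rewrite (perm_mem pw) mem_enum inE. Qed.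

Lemma prodv_not_input r : prodv G r \notin input_vertices G.
Proof.
apply: contraL (introT (isCP _) (proj1 (dag_prod G r))) => /input_notC //.
Qed.

Lemma schedule_prodv w r : is_schedule H w -> prodv G r \in computed w.
Proof. by case=> pw _; rewrite (perm_mem pw) mem_enum inE prodv_not_input. Qed.

(** The maps being onto, every entry of a and b is needed by some product and must be read. Outputs
    start outside memory and must be written. All these vertices are distinct within the reads and
    within the writes. *)
Lemma vertical_cost_ge_inputs_outputs w : is_schedule H w ->
    (forall i, exists r, gA r = i) -> (forall i, exists r, gB r = i) ->
    (forall i, exists r, gC r = i) ->
  (nA alg + nB alg + nC alg <= vertical_cost w)%N.
Proof.
move=> sw sA sB sC; have [pw [st rw outm]] := sw.
have nin := schedule_not_input sw; have pc r := schedule_prodv r sw.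
have vinA i : (valA (inA G i))^T = delta_mx 0 i.
  by have [_ ->] := dag_inA G i; rewrite trmx_delta.
have vinB i : (valB (inB G i))^T = delta_mx 0 i.
  by have [_ ->] := dag_inB G i; rewrite trmx_delta.
have inpA x : x \in input_vertices G -> isA x -> exists i, x = inA G i.
  rewrite inE => /eqP/dag_inputs[] // [i ->].
  by rewrite /isA; have [-> _] := dag_inB G i.
have inpB x : x \in input_vertices G -> isB x -> exists i, x = inB G i.
  rewrite inE => /eqP/dag_inputs[] // [i ->].
  by rewrite /isB; have [-> _] := dag_inA G i.
have rA := inputs_read (@sum_partA _ _ G) prod_operandA inpA vinA sA rw nin pc.
have rB := inputs_read (@sum_partB _ _ G) prod_operandB inpB vinB sB rw nin pc.
have delta_inj N (f : 'I_N -> G) (val : G -> 'rV[R]_N) :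
    (forall i, val (f i) = delta_mx 0 i) -> injective f.
  move=> vf i j fij; have := congr1 (fun x => val x 0 j) fij.
  rewrite /= !vf !mxE !eqxx /=; case: eqP => // _ /eqP.
  by rewrite eq_sym oner_eq0.
have injA := delta_inj _ (inA G) (fun x => (valA x)^T) vinA.
have injB := delta_inj _ (inB G) (fun x => (valB x)^T) vinB.
have outw i : outv G i \in writes w.
  have [//|//|//|_ _ mw] := @run_invariant _ _ _ _ (fun _ => True) w _ _ rw.
  have [xI|[]//] := mw _ (outm i).
  have [/isCP Ci _] := dag_out G i.
  by have := input_notC xI; rewrite Ci.
(* A shared vertex would give [FC] two equal rows, but column [r] has its only nonzero entry in row
   [i]. *)
have out_inj : injective (outv G).
  move=> i j ij; have [r gr] := sC i.
  have [_ vi] := dag_out G i; have [_ vj] := dag_out G j.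
  have : FC alg i r = FC alg j r.
    by move: vi; rewrite ij vj => /rowP/(_ r); rewrite !mxE.
  rewrite !FCE gr eqxx; case: eqP => // _ /eqP.
  by rewrite (negbTE (a_neq0 r)).
rewrite cost_reads_writes leq_add //; last first.
  rewrite -[X in (X <= _)%N]card_ord cardE -(size_map (outv G)).
  apply: uniq_leq_size; first by rewrite map_inj_uniq ?enum_uniq.
  by move=> x /mapP[i _ ->].
rewrite -[X in (X + _ <= _)%N]card_ord -[X in (_ + X <= _)%N]card_ord !cardE.
rewrite -(size_map (inA G)) -(size_map (inB G)) -size_cat.
apply: uniq_leq_size.
  rewrite cat_uniq (map_inj_uniq injA) (map_inj_uniq injB) !enum_uniq andbT /=.
  apply/hasPn => x /mapP[i _ ->]; apply/mapP => -[j _ ji].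
  by have := proj1 (dag_inB G i); rewrite ji (proj1 (dag_inA G j)).
by move=> x; rewrite mem_cat => /orP[] /mapP[i _ ->].
Qed.

(** Taken as the complement of part C, so that with the cached vertices of part C it makes up the
    cache exactly. *)
Definition cached_operands st := count (predC (@isC _ _ G)) (enum (cache st)).

Hypothesis gABC : expansion K gA gB gC.

(** The three numbers count the entries of A, B and C involved in the segment. Operands are charged
    to reads and outputs to writes, so no transfer is charged twice. *)
Lemma segment_bound w1 w2 w3 st1 st2 st3 :
    uniq (computed (w1 ++ w2 ++ w3)) ->
    (forall x, x \in computed (w1 ++ w2 ++ w3) -> x \notin input_vertices G) ->
    run H (initial_state G) w1 = Some st1 -> run H st1 w2 = Some st2 ->
    run H st2 w3 = Some st3 -> (forall i, outv G i \in memory st3) ->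
  exists x y z, (product_count w2 ^ 2 <= K * (x * y * z))%N /\
    (x + y + z <= cached_operands st1 + #|[set u in cache st2 | isC u]|
                  + vertical_cost w2)%N.
Proof.
move=> uw nin rw1 rw2 rw3 outm.
exists #|gA @: products w2|, #|gB @: products w2|, #|gC @: products w2|; split.
  rewrite -card_products //; move: uw; rewrite !computed_cat !cat_uniq.
  by case/and5P.
have nin2 x : x \in computed w2 -> x \notin input_vertices G.
  by move=> xw; apply: nin; rewrite !computed_cat !mem_cat xw orbT.
have := card_operands (@sum_partA _ _ G) prod_operandA nin2 rw2.
have := card_operands (@sum_partB _ _ G) prod_operandB nin2 rw2.
have := card_outputs a_neq0 FCE uw nin rw1 rw2 rw3 outm.
rewrite !card_sep cost_reads_writes /cached_operands.
have := count_operands (enum (cache st1)).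
have := count_operands (reads w2).
have := count_size (predC (@isC _ _ G)) (reads w2).
have := count_size (@isC _ _ G) (writes w2).
lia.
Qed.

Hypothesis K_gt0 : (0 < K)%N.

(* Segments of [m] products, with [m] such that an expansion of size at least
   [m] forces x + y + z >= 3 H.  Of these 3 H, the cache provides at most H at
   each interior boundary, counting the operands for the segment after it and
   the partial outputs for the one before it. *)
Lemma suffix_bound (y : R) w1 w2 st st' : (2 < H)%N -> 0 <= y -> y ^+ 2 = (K * H)%:R ->
    uniq (computed (w1 ++ w2)) ->
    (forall x, x \in computed (w1 ++ w2) -> x \notin input_vertices G) ->
    run H (initial_state G) w1 = Some st -> run H st w2 = Some st' ->
    (forall i, outv G i \in memory st') -> cache st' = set0 ->
  2 * (product_count w2)%:R <= y * (vertical_cost w2 + cached_operands st)%:R.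
Proof.
move=> H_gt2 y0 y2; have [m /andP[mlo mhi]] := exists_block_size K_gt0 H_gt2.
have m0 : (0 < m)%N by case: (m) mlo.
(* Induction on the number of products left in the suffix. *)
have [k] := ubnP (product_count w2); elim: k w1 w2 st => // k IH w1 w2 st.
rewrite ltnS => w2k uw nin rw1 rw2 outm c0.
case: (ltnP (product_count w2) m) => [pm|/split_product_count[u1 [u2 [w2E cu1]]]].
  have [] := @segment_bound w1 w2 [::] st st' st' _ _ rw1 rw2 erefl outm;
    rewrite ?cats0 // => a1 [a2 [a3 [pK]]].
  have -> : [set u in cache st' | isC u] = set0.
    by apply/setP => u; rewrite c0 !inE.
  rewrite cards0 addn0 [X in (_ <= X)%N]addnC.
  set p := product_count w2 in pm pK *.
  set D := (vertical_cost w2 + _)%N => aD.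
  (* In the last, short segment the final cache is empty, so [D] bounds the sum of the three numbers
     and AM-GM bounds their product. *)
  have D3 : (27 * p ^ 2 <= K * D ^ 3)%N.
    have := leq_amgm3 a1 a2 a3.
    have : ((a1 + a2 + a3) ^ 3 <= D ^ 3)%N by rewrite leq_exp2r.
    nia.
  have pH : (p ^ 2 <= K * H ^ 3)%N.
    by apply: leq_trans mhi; rewrite leq_sqr ltnW.
  (* If [D <= 2 H], then [D3] suffices; otherwise [pH] gives [4 p^2 <= K H (2 H)^2]. *)
  have pD : (4 * p ^ 2 <= K * H * D ^ 2)%N.
    case: (leqP D (2 * H)) => [DH|/ltnW HD].
      have : (K * D ^ 3 <= K * D ^ 2 * (2 * H))%N.
        by rewrite expnSr mulnA leq_mul2l DH orbT.
      nia.
    have : (K * H * (2 * H) ^ 2 <= K * H * D ^ 2)%N.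
      by rewrite leq_mul2l leq_sqr HD orbT.
    nia.
  rewrite -ler_sqr ?nnegrE ?mulr_ge0 // !exprMn y2 -!natrX -!natrM ler_nat.
  exact: pD.
move: rw2; rewrite w2E run_cat.
case rwu1: (run H st u1) => [st1|] //= rwu2.
have rwu : run H (initial_state G) (w1 ++ u1) = Some st1 by rewrite run_cat rw1.
rewrite w2E in uw nin.
have [a1 [a2 [a3 [pK aD]]]] := @segment_bound w1 u1 u2 _ _ _ uw nin rw1 rwu1 rwu2 outm.
have pE : product_count w2 = (m + product_count u2)%N.
  by rewrite w2E /product_count computed_cat count_cat -!/(product_count _) cu1.
have u2k : (product_count u2 < k)%N by lia.
have := IH (w1 ++ u1) u2 st1 u2k.
rewrite -catA => /(_ uw nin rwu rwu2 outm c0) IH'.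
(* [m ^ 2] exceeds [K] times any product of three numbers with sum below [3 * H]. *)
have H3 : (3 * H <= a1 + a2 + a3)%N.
  rewrite leqNgt; apply/negP => /leq_mul3_lt_sum amh.
  have := leq_trans mlo (leq_trans _ (leq_mul (leqnn K) amh)).
  by rewrite -cu1 => /(_ pK); rewrite ltnn.
have cH : (cached_operands st1 + #|[set u in cache st1 | isC u]| <= H)%N.
  have := run_cache_bound rwu; rewrite cards0 => /(_ isT).
  by rewrite card_sep /cached_operands addnC count_predC -cardE.
(* [m^2 <= K H^3 = (y H)^2], so the [2 H] gained in this segment pay for its [m] products. *)
have mH : m%:R <= y * H%:R.
  rewrite -ler_sqr ?nnegrE ?mulr_ge0 // exprMn y2 -!natrX -natrM ler_nat.
  by apply: leq_trans mhi _; rewrite -mulnA leq_mul2l -expnS leqnn orbT.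
rewrite -w2E pE natrD mulrDr.
have step : (2 * H + (vertical_cost u2 + cached_operands st1)
             <= vertical_cost w2 + cached_operands st)%N.
  by rewrite w2E cost_cat; lia.
apply: (@le_trans _ _ (y * (2 * H + (vertical_cost u2 + cached_operands st1))%:R)).
  by rewrite natrD mulrDr lerD // natrM mulrCA ler_pM2l.
by rewrite ler_wpM2l // ler_nat.
Qed.

Lemma schedule_product_count w : is_schedule H w ->
  product_count w = brank alg.
Proof.
move=> sw; have uw : uniq (computed w) by rewrite (perm_uniq (proj1 sw)) enum_uniq.
rewrite -card_products // -[RHS]card_ord -cardsT; congr #|pred_of_set _|.
by apply/setP => r; rewrite !inE schedule_prodv.
Qed.

Lemma vertical_cost_ge_products w : (0 < brank alg)%N -> is_schedule H w ->
  2 * (brank alg)%:R <= Num.sqrt (K * H)%:R * (vertical_cost w)%:R :> R.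
Proof.
move=> b0 sw; have [pw [st rw outm]] := sw.
have H2 := cache_size_gt2 rw (schedule_prodv (Ordinal b0) sw).
(* Emptying the cache at the end is free, and removes the final cache content
   from the estimate. *)
pose w' := w ++ [seq Discard x | x <- enum G].
have cw' : computed w' = computed w.
  rewrite computed_cat -[RHS]cats0; congr (_ ++ _).
  by elim: (enum G).
have vw' : vertical_cost w' = vertical_cost w.
  by rewrite cost_cat -[RHS]addn0; congr addn; elim: (enum G).
have rw' : run H (initial_state G) w' = Some (MachineState set0 (memory st)).
  rewrite run_cat rw /= run_discard; congr (Some (MachineState _ _)).
  by apply/setP => x; rewrite !inE mem_enum.
have := @suffix_bound (Num.sqrt (K * H)%:R) [::] w' _ _ H2 (sqrtr_ge0 _)
  (sqr_sqrtr (ler0n _ _)) _ _ erefl rw' outm erefl.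
rewrite /= /cached_operands enum_set0 addn0 vw' /product_count cw'.
rewrite -/(product_count w) schedule_product_count //; apply.
  by rewrite (perm_uniq pw) enum_uniq.
exact: schedule_not_input.
Qed.

End LowerBound.

(** * Splitting and merging sorted tuples *)

Lemma perm_mask_negb (T : eqType) (m : bitseq) (k : seq T) :
  size m = size k -> perm_eq (mask m k ++ mask (map negb m) k) k.
Proof.
elim: m k => [|[] m IH] [|x k] //= [/IH mk]; first by rewrite perm_cons.
by rewrite perm_catC /= perm_cons perm_catC.
Qed.

(** Choose a mask for each pair. The mask determines the pair, and its true positions form a
    [q]-subset of the [q + r] positions. *)
Lemma card_chi (T : finType) (q r : nat) (k : (q + r).-tuple T) :
  (#|chi k| <= 'C(q + r, q))%N.
Proof.
pose P (p : q.-tuple T * r.-tuple T) (m : (q + r).-tuple bool) :=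
  (mask m k == p.1 :> seq T) && (mask (map negb m) k == p.2 :> seq T).
pose A (m : (q + r).-tuple bool) := [set i | tnth m i].
have A_inj : injective A.
  by move=> m m' /setP mm'; apply: eq_from_tnth => i; have := mm' i; rewrite !inE.
have [f fP] : exists f : q.-tuple T * r.-tuple T -> (q + r).-tuple bool,
    forall p, p \in chi k -> P p (f p).
  apply: (@fin_all_exists _ _ (fun p m => p \in chi k -> P p m)) => p.
  (* Off [chi k] the all-false mask serves as a dummy value. *)
  case: (boolP (p \in chi k)) => [|_]; last by exists [tuple of nseq _ false].
  by rewrite inE => /existsP[m Pm]; exists m.
have Af_inj : {in chi k &, injective (A \o f)}.
  move=> p p' /fP/andP[/eqP p1 /eqP p2] /fP/andP[/eqP p1' /eqP p2'] /A_inj fpp'.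
  rewrite (surjective_pairing p) (surjective_pairing p').
  by congr pair; apply: val_inj; rewrite /= -?p1 -?p2 fpp' ?p1' ?p2'.
rewrite -(card_in_imset Af_inj) -[X in 'C(X, _)]card_ord -card_draws.
apply/subset_leq_card/subsetP => _ /imsetP[p /fP/andP[/eqP p1 _] ->].
have := congr1 size p1; rewrite size_mask ?size_tuple // => fq.
rewrite inE; apply/eqP/(etrans _ fq).
rewrite cardsE cardE size_filter -enumT -[in RHS](map_tnth_enum (f p)) count_map.
exact: eq_count.
Qed.

Section Merge.

Variable n : nat.

Definition ord_leq : rel 'I_n := relpre val leq.

Lemma ord_leq_total : total ord_leq.
Proof. by move=> x y; apply: leq_total. Qed.
Lemma ord_leq_trans : transitive ord_leq.
Proof. by move=> x y z; apply: leq_trans. Qed.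
Lemma ord_leq_anti : antisymmetric ord_leq.
Proof. by move=> x y /anti_leq/val_inj. Qed.

Lemma sorted_tupleP d (x : sorted_tuple n d) : sorted ord_leq (val x).
Proof. by rewrite -sorted_map (valP x). Qed.

Definition SortedTuple d (x : d.-tuple 'I_n) (xs : sorted ord_leq x) :
  sorted_tuple n d := exist _ x (etrans (sorted_map _) xs).

Definition merge_sorted q r (x : sorted_tuple n q) (y : sorted_tuple n r) :
  sorted_tuple n (q + r) :=
  @SortedTuple _ [tuple of sort ord_leq (val x ++ val y)]
    (sort_sorted ord_leq_total _).

(** A sorted tuple is determined by its multiset of entries, so a pair splits exactly one. Hence
    every column of the three matrices has a single nonzero entry. *)
Lemma chi_merge q r (x : sorted_tuple n q) (y : sorted_tuple n r)
    (g : sorted_tuple n (q + r)) :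
  ((val x, val y) \in chi (val g)) = (g == merge_sorted x y).
Proof.
rewrite inE; apply/existsP/eqP => [[m /= /andP[/eqP mx /eqP my]]|->].
  apply/val_inj/val_inj => /=.
  apply: (sorted_eq ord_leq_trans ord_leq_anti) (sorted_tupleP g) _ _.
    exact/sort_sorted/ord_leq_total.
  by rewrite perm_sym perm_sort -mx -my perm_mask_negb // !size_tuple.
set s := sort ord_leq (val x ++ val y).
have s_sorted : sorted ord_leq s by apply/sort_sorted/ord_leq_total.
(* Sorting [x ++ y] keeps the sorted [x] as a subsequence; the rest is sorted with the entries of
   [y], hence equals [y]. *)
have : subseq (val x) s.
  rewrite -(sorted_sort ord_leq_trans (sorted_tupleP x)).
  by apply: (subseq_sort ord_leq_total ord_leq_trans); apply: prefix_subseq.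
case/subseqP => m sm xm.
have sz : size m == (q + r)%N by rewrite sm size_sort size_cat !size_tuple.
exists (Tuple sz) => /=; rewrite -xm eqxx /=; apply/eqP.
apply: (sorted_eq ord_leq_trans ord_leq_anti) _ (sorted_tupleP y) _.
  exact: subseq_sorted ord_leq_trans _ _ (mask_subseq _ _) s_sorted.
rewrite -(perm_cat2l (val x)) {1}xm -(permPr (permEl (perm_sort ord_leq _))).
exact: perm_mask_negb.
Qed.

Lemma merge_sorted_surj q r (g : sorted_tuple n (q + r)) :
  exists x y, merge_sorted x y = g.
Proof.
have szt : size (take q (val g)) == q by rewrite size_takel ?size_tuple ?leq_addr.
have szd : size (drop q (val g)) == r by rewrite size_drop size_tuple addKn.
have gs := sorted_tupleP g.
have st : sorted ord_leq (Tuple szt) by apply: take_sorted.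
have sd : sorted ord_leq (Tuple szd) by apply: drop_sorted.
exists (SortedTuple st), (SortedTuple sd); apply/val_inj/val_inj => /=.
by rewrite cat_take_drop sorted_sort //; apply: ord_leq_trans.
Qed.

(** The pairs merging to [g] lie in [chi g], whose size [card_chi] bounds. This turns projections of
    columns into tensor entries. *)
Lemma card_merge_fibres (D : finType) q r (S : {set D})
    (f : D -> sorted_tuple n q * sorted_tuple n r) :
  (#|f @: S| <= 'C(q + r, q) * #|(fun c => merge_sorted (f c).1 (f c).2) @: S|)%N.
Proof.
rewrite (imset_comp (fun p => merge_sorted p.1 p.2) f).
apply: leq_card_fibres => g; apply: leq_trans (card_chi (val g)).
have inj : injective (fun p : sorted_tuple n q * sorted_tuple n r => (val p.1, val p.2)).
  by move=> [x y] [x' y'] /= [/val_inj -> /val_inj ->].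
rewrite -(card_imset _ inj); apply/subset_leq_card/subsetP => _ /imsetP[p + ->].
by rewrite inE chi_merge => /andP[_ /eqP <-].
Qed.

End Merge.

(** * The direct evaluation algorithm as an instance *)

Lemma card_sorted_tuple n d : (0 < n)%N ->
  #|{: sorted_tuple n d}| = 'C(n + d - 1, d).
Proof.
case: n => // n _; rewrite card_sig addSn subn1 /= addnC -card_sorted_tuples.
by apply: eq_card => x; rewrite inE.
Qed.

Lemma sorted_tuple_inhabited n d : (0 < n)%N -> sorted_tuple n d.
Proof.
case: n => // n _; apply: (@SortedTuple _ _ [tuple of nseq d ord0]).
by elim: d => // -[|d].
Qed.

Lemma rho_neq0 (R : realType) (T : finType) v (k : v.-tuple T) : rho R k != 0.
Proof.
rewrite mulf_neq0 ?invr_eq0 ?pnatr_eq0 -?lt0n ?fact_gt0 //.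
by apply: prodn_gt0 => x; apply: fact_gt0.
Qed.

Section DirectEvaluation.

Variables (R : realType) (n s t v : nat).

Let column := (sorted_tuple n s * sorted_tuple n t * sorted_tuple n v)%type.

Definition entryA (c : column) := merge_sorted c.1.1 c.2.
Definition entryB (c : column) := merge_sorted c.2 c.1.2.
Definition entryC (c : column) := merge_sorted c.1.1 c.1.2.

Definition coefC (c : 'I_#|{: column}|) : R :=
  s`!%:R * t`!%:R * rho R (val (enum_val c).2).

Definition rank_entry d (e : column -> sorted_tuple n d) (c : 'I_#|{: column}|) :
  'I_#|{: sorted_tuple n d}| := enum_rank (e (enum_val c)).

Lemma coefC_neq0 c : coefC c != 0.
Proof.
by rewrite mulf_neq0 ?rho_neq0 // -natrM pnatr_eq0 -lt0n muln_gt0 !fact_gt0.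
Qed.

Lemma direct_FA i c :
  FA (direct_evaluation R n s t v) i c = (i == rank_entry entryA c)%:R.
Proof.
rewrite mxE /directA /rank_entry /entryA; case: (enum_val c) => -[j l] k /=.
by rewrite chi_merge (can2_eq (@enum_valK _) (@enum_rankK _)).
Qed.

Lemma direct_FB i c :
  FB (direct_evaluation R n s t v) i c = (i == rank_entry entryB c)%:R.
Proof.
rewrite mxE /directB /rank_entry /entryB; case: (enum_val c) => -[j l] k /=.
by rewrite chi_merge (can2_eq (@enum_valK _) (@enum_rankK _)).
Qed.

Lemma direct_FC i c : FC (direct_evaluation R n s t v) i c =
  if i == rank_entry entryC c then coefC c else 0.
Proof.
rewrite mxE /directC /rank_entry /entryC /coefC; case: (enum_val c) => -[j l] k /=.
by rewrite chi_merge (can2_eq (@enum_valK _) (@enum_rankK _)).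
Qed.

Lemma card_rank_entry d (e : column -> sorted_tuple n d) (S : {set 'I_#|{: column}|}) :
  #|rank_entry e @: S| = #|e @: (enum_val @: S)|.
Proof.
rewrite -(card_imset (e @: (enum_val @: S)) enum_rank_inj) -!imset_comp.
by [].
Qed.

(** Loomis-Whitney on the triples [(j, l, k)]; merging each of the three projections costs one of
    the binomial factors. *)
Lemma direct_expansion : expansion ('C(s + v, s) * 'C(v + t, v) * 'C(s + t, s))
  (rank_entry entryA) (rank_entry entryB) (rank_entry entryC).
Proof.
move=> S; rewrite !card_rank_entry -(card_imset S enum_val_inj).
apply: leq_trans (loomis_whitney _) _.
set S' := enum_val @: S.
have eA := card_merge_fibres S' (fun c : column => (c.1.1, c.2)).
have eB := card_merge_fibres S' (fun c : column => (c.2, c.1.2)).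
have eC := card_merge_fibres S' (fun c : column => c.1).
have -> : forall k1 k2 k3 x y z : nat,
    (k1 * k2 * k3 * (x * y * z) = k1 * x * (k2 * y) * (k3 * z))%N by lia.
exact: leq_mul (leq_mul eA eB) eC.
Qed.

Hypothesis n_gt0 : (0 < n)%N.

Lemma rank_entry_surj d (e : column -> sorted_tuple n d) :
  (forall g, exists c, e c = g) -> forall i, exists c, rank_entry e c = i.
Proof.
move=> esurj i; have [c ec] := esurj (enum_val i).
by exists (enum_rank c); rewrite /rank_entry enum_rankK ec enum_valK.
Qed.

Lemma entryA_surj g : exists c, entryA c = g.
Proof.
have [j [k <-]] := merge_sorted_surj g.
by exists (j, sorted_tuple_inhabited t n_gt0, k).
Qed.

Lemma entryB_surj g : exists c, entryB c = g.
Proof.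
have [k [l <-]] := merge_sorted_surj g.
by exists (sorted_tuple_inhabited s n_gt0, l, k).
Qed.

Lemma entryC_surj g : exists c, entryC c = g.
Proof.
have [j [l <-]] := merge_sorted_surj g.
by exists (j, l, sorted_tuple_inhabited v n_gt0).
Qed.

End DirectEvaluation.

Theorem theorem10p2 (R : realType) (s t v : nat) :
  exists n0 : nat, forall n : nat, (n0 <= n)%N ->
  forall H : nat, (1 <= H)%N ->
  forall (G : execution_dag (direct_evaluation R n s t v)) (w : seq (instr G)),
    is_schedule H w ->
    let q : R :=
      Num.sqrt ('C(s + v, s) * 'C(v + t, v) * 'C(s + t, s))%N%:R in
    Num.max
      (2 * 'C(n + s - 1, s)%:R * 'C(n + t - 1, t)%:R * 'C(n + v - 1, v)%:R
         / (q * Num.sqrt H%:R))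
      ('C(n + s + v - 1, s + v)%:R + 'C(n + v + t - 1, v + t)%:R
         + 'C(n + s + t - 1, s + t)%:R)
    <= (vertical_cost w)%:R.
Proof.
(* [0 < n] makes all index sets inhabited, so the three entry maps are onto and the rank is
   positive. *)
exists 1%N => n n0 H H0 G w sw; cbv zeta.
have K0 : (0 < 'C(s + v, s) * 'C(v + t, v) * 'C(s + t, s))%N.
  by rewrite !muln_gt0 !bin_gt0 !leq_addr.
rewrite ge_max; apply/andP; split; last first.
  have := vertical_cost_ge_inputs_outputs (@direct_FA R n s t v) (@direct_FB R n s t v)
    (@coefC_neq0 R n s t v) (@direct_FC R n s t v) sw
    (rank_entry_surj (entryA_surj t n0)) (rank_entry_surj (entryB_surj s n0))
    (rank_entry_surj (entryC_surj v n0)).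
  by rewrite /= !card_sorted_tuple // !addnA -!natrD ler_nat.
have rankE : brank (direct_evaluation R n s t v) =
    ('C(n + s - 1, s) * 'C(n + t - 1, t) * 'C(n + v - 1, v))%N.
  by rewrite /= !card_prod !card_sorted_tuple.
have b0 : (0 < brank (direct_evaluation R n s t v))%N.
  by rewrite rankE !muln_gt0 !bin_gt0; lia.
have := vertical_cost_ge_products (@direct_FA R n s t v) (@direct_FB R n s t v)
  (@coefC_neq0 R n s t v) (@direct_FC R n s t v) (@direct_expansion n s t v) K0 b0 sw.
rewrite rankE ler_pdivrMr; last by rewrite mulr_gt0 // sqrtr_gt0 ltr0n.
(* The expansion constant is [q ^ 2], so the root splits as [q] times the root of [H]. *)
rewrite [(_ * H)%:R]natrM sqrtrM ?ler0n // [X in _ <= X]mulrC.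
by rewrite 2!natrM !mulrA.
Qed.
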